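(* For every $C>0$ there is a constant $C'>0$ depending only on $C$ such that the following holds. For every positive integer $n$, every $C$-dense $n$-element point set $P$ in the plane, and every stacking order $f$ of $\mathcal{D}(P)$, $$\lim_{\varepsilon\to 0}\mathrm{vis}(\mathcal{D}(\varepsilon P),f)\le C' n^{3/4},$$ where $f$ also denotes the corresponding stacking order of $\mathcal{D}(\varepsilon P)$.
   Context: For a point $p$ in the plane, $D(p)$ denotes the closed disk of radius $1$ centered at $p$, and for a finite point set $P$, $\mathcal{D}(P)=\{D(p): p\in P\}$. A stacking order of a finite collection $\mathcal{D}$ of $n$ distinct unit disks is a bijection $f:\mathcal{D}\to\{1,\dots,n\}$; $f(D)$ is regarded as the height of $D$, and the arrangement is viewed from below. A point $x$ on the boundary circle of $D\in\mathcal{D}$ is visible if $x$ does not lie in any disk $D'\in\mathcal{D}$ with $f(D')<f(D)$. The visible perimeter $\mathrm{vis}(\mathcal{D},f)$ is the total length of all visible boundary points, summed over all disks of $\mathcal{D}$. For $\varepsilon>0$, $\varepsilon P=\{(\varepsilon x,\varepsilon y): (x,y)\in P\}$, and a stacking order $f$ of $\mathcal{D}(P)$ is identified with the stacking order $D(\varepsilon p)\mapsto f(D(p))$ of $\mathcal{D}(\varepsilon P)$. An $n$-element point set $P$ is $C$-dense if $\max\{|pq|: p,q\in P\}\,/\,\min\{|pq|: p,q\in P,\ p\ne q\}\le C n^{1/2}$. *)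

(* Defs.v *)
From HB Require Import structures.
From mathcomp Require Import all_boot all_order all_fingroup all_algebra.
From mathcomp Require Import all_classical all_reals all_analysis.
Set Implicit Arguments. Unset Strict Implicit. Unset Printing Implicit Defensive.
Import Order.TTheory GRing.Theory Num.Theory.
Import numFieldNormedType.Exports.
Local Open Scope classical_set_scope.
Local Open Scope ring_scope.

Section Disks.
Variable R : realType.

Definition pt := (R * R)%type.

Definition dist (p q : pt) : R :=
  Num.sqrt ((p.1 - q.1) ^+ 2 + (p.2 - q.2) ^+ 2).

Definition unit_disk (p : pt) : set pt :=
  [set x | (x.1 - p.1) ^+ 2 + (x.2 - p.2) ^+ 2 <= 1].

Definition circ_pt (p : pt) (t : R) : pt := (p.1 + cos t, p.2 + sin t).

(* A point x on the boundary of D(P i) is visible w.r.t. the stacking order f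
   (heights f j) if it lies in no disk D(P j) with f j < f i. *)
Definition visible n (P : 'I_n -> pt) (f : {perm 'I_n}) (i : 'I_n) (x : pt) :=
  forall j : 'I_n, (f j < f i)%N -> ~ unit_disk (P j) x.

(* The visible part of the boundary circle of D(P i), parametrized by the
   arc-length (angle) parameter t in [0, 2pi). *)
Definition visible_angles n (P : 'I_n -> pt) (f : {perm 'I_n}) (i : 'I_n)
  : set R :=
  [set t | (0 <= t < 2 * pi) /\ visible P f i (circ_pt (P i) t)].

Definition vis n (P : 'I_n -> pt) (f : {perm 'I_n}) : \bar R :=
  (\sum_(i < n) (@lebesgue_measure R) (visible_angles P f i))%E.

Definition scale_pts n (eps : R) (P : 'I_n -> pt) : 'I_n -> pt :=
  fun i => (eps * (P i).1, eps * (P i).2).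

(* C-dense: max |pq| / min_{p<>q} |pq| <= C n^(1/2), written without
   division (for n = 1 the min is over the empty set; the condition is then
   vacuous). *)
Definition C_dense n (C : R) (P : 'I_n -> pt) :=
  forall i j k l : 'I_n, k != l ->
    dist (P i) (P j) <= C * Num.sqrt (n%:R) * dist (P k) (P l).

End Disks.

(* Main.v *)
(** As eps -> 0 the visible part of the circle of D(eps p_i) shrinks to the set
    A_i of directions in which p_i is at least as high as every p_j stacked
    below it, so the limit is the sum of the lengths of the A_i. Each A_i is an
    arc. Let r be the minimum distance in P. Away from the two ends of A_i, by
    an angle d, the point p_i is higher than all earlier points by at least
    r sin d; and in a fixed direction at most 1 + diam(P) / (r sin d) points
    can do so, since the heights vary by at most diam(P). Hence the limit is
    O(n d) + O(1 + C sqrt n / sin d), and d = n^(-1/4) gives n^(3/4). *)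

Require Import Defs.
From HB Require Import structures.
From mathcomp Require Import all_boot all_order all_fingroup all_algebra.
From mathcomp Require Import all_classical all_reals all_analysis.
From mathcomp Require Import measurable_realfun ring lra.
Import Order.TTheory GRing.Theory Num.Theory.
Import numFieldNormedType.Exports.
Local Open Scope classical_set_scope.
Local Open Scope ring_scope.

(** * Heights of planar points in a rotating direction *)

Section Height.
Context {R : realType}.
Implicit Types (p q v : pt R) (t u d r : R).

Definition height p t : R := p.1 * cos t + p.2 * sin t.

Definition sqnorm v : R := v.1 ^+ 2 + v.2 ^+ 2.

Lemma sqnorm_ge0 v : 0 <= sqnorm v.
Proof. by rewrite addr_ge0// sqr_ge0. Qed.

Lemma sqnorm_eq0 v : sqnorm v = 0 -> v = 0.
Proof.
move=> /eqP; rewrite paddr_eq0 ?sqr_ge0// !sqrf_eq0.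
by case: v => a b /= /andP[/eqP -> /eqP ->].
Qed.

Lemma heightB p q t : height (p - q) t = height p t - height q t.
Proof. rewrite /height /=; ring. Qed.

Lemma height_sqr_le v t : height v t ^+ 2 <= sqnorm v.
Proof.
have cs := cos2Dsin2 t.
have -> : sqnorm v = height v t ^+ 2 + (v.2 * cos t - v.1 * sin t) ^+ 2.
  rewrite -[LHS]mulr1 -cs /sqnorm /height; ring.
by rewrite lerDl sqr_ge0.
Qed.

Lemma dist_sqr p q : dist p q ^+ 2 = sqnorm (p - q).
Proof. by rewrite sqr_sqrtr// addr_ge0// sqr_ge0. Qed.

Lemma heightB_le_dist p q t : height p t - height q t <= dist p q.
Proof.
rewrite -heightB (le_trans (ler_norm _))//.
rewrite -(@ler_pXn2r _ 2)// ?nnegrE ?sqrtr_ge0//.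
by rewrite dist_sqr real_normK ?num_real// height_sqr_le.
Qed.

(** With h the height at t and w the component of v orthogonal to that direction, the heights at t +
    d and t - d multiply to h^2 cos^2 d - w^2 sin^2 d. This being nonnegative, h^2 >= (h^2 + w^2)
    sin^2 d = |v|^2 sin^2 d. *)
Lemma height_rotations v t d r : 0 <= r -> r ^+ 2 <= sqnorm v -> 0 <= sin d ->
  0 <= height v t -> 0 <= height v (t + d) -> 0 <= height v (t - d) ->
  r * sin d <= height v t.
Proof.
move=> r0 rv s0 h0 hp hm.
rewrite -(@ler_pXn2r _ 2)// ?nnegrE ?mulr_ge0//.
set w := v.2 * cos t - v.1 * sin t.
have cst := cos2Dsin2 t; have csd := cos2Dsin2 d.
have hw : sqnorm v = height v t ^+ 2 + w ^+ 2.
  rewrite -[LHS]mulr1 -cst /sqnorm /height /w; ring.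
have prod : 0 <= (height v t * cos d) ^+ 2 - (w * sin d) ^+ 2.
  have -> : (height v t * cos d) ^+ 2 - (w * sin d) ^+ 2 =
      height v (t + d) * height v (t - d).
    rewrite /height !cosD !sinD cosN sinN /w; ring.
  exact: mulr_ge0.
rewrite exprMn (le_trans (ler_wpM2r (sqr_ge0 _) rv))// hw.
rewrite -[leRHS]mulr1 -csd; move: prod; rewrite !exprMn => prod; lra.
Qed.

(** On an arc shorter than a half-turn, the direction x is a nonnegative combination of the
    directions t and u, and height is linear in the direction. *)
Lemma height_between v t u x : t <= x <= u -> u - t < pi ->
  0 <= height v t -> 0 <= height v u -> 0 <= height v x.
Proof.
move=> /andP[tx xu] ut ht hu.
have [tu|ntu] := eqVneq t u.
  by have -> : x = t by apply/eqP; rewrite eq_le tx tu xu.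
have tu : t < u by rewrite lt_neqAle ntu (le_trans tx).
have s0 : 0 < sin (u - t) by apply: sin_gt0_pi; rewrite subr_gt0 tu.
rewrite -(pmulr_rge0 _ s0).
have -> : sin (u - t) * height v x =
    sin (u - x) * height v t + sin (x - t) * height v u.
  rewrite !sinB /height; ring.
rewrite addr_ge0// mulr_ge0// sin_ge0_pi//; lra.
Qed.

Lemma narrow_set (S : set R) d :
  (forall x y, S x -> S y -> y <= x + d) ->
  exists c, S `<=` `[c - d, c + d]%classic.
Proof.
move=> Sd; have [[c Sc]|/nonemptyPn->] := pselect (S !=set0); last by exists 0.
exists c => x Sx; rewrite /= in_itv/= lerBlDr.
by rewrite !Sd.
Qed.

(* The set K of t with 0 <= height v t for all v in V is an arc. At a point
   that stays in K when rotated by d either way, all heights are at least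
   r * sin d; the other points of K are within d of an end of K. *)
Lemma low_angles_narrow (V : set (pt R)) a d r : 0 <= r -> 0 <= d <= pi ->
  (forall v, V v -> r ^+ 2 <= sqnorm v) ->
  exists c c', forall t, a <= t < a + pi ->
    (forall v, V v -> 0 <= height v t) ->
    [\/ forall v, V v -> r * sin d <= height v t,
        `[c - d, c + d]%classic t | `[c' - d, c' + d]%classic t].
Proof.
move=> r0 dpi Vr; have /andP[d0 _] := dpi.
pose K : set R := [set t | a <= t < a + pi /\ forall v, V v -> 0 <= height v t].
have [c cP] : exists c,
    [set t | K t /\ exists2 v, V v & height v (t + d) < 0] `<=`
    `[c - d, c + d]%classic.
  (* If y > x + d, then x + d lies between two points of [K] less than pi apart, so v cannot have
     negative height there. *)
  apply: narrow_set => x y [[/andP[ax xa] Kx] [v Vv hv]] [[/andP[ay ya] Ky] _].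
  rewrite leNgt; apply: contraTN hv => xy; rewrite -leNgt.
  by apply: (@height_between _ x y); [lra|lra|exact: Kx|exact: Ky].
have [c' c'P] : exists c,
    [set t | K t /\ exists2 v, V v & height v (t - d) < 0] `<=`
    `[c - d, c + d]%classic.
  apply: narrow_set => x y [[/andP[ax xa] Kx] _] [[/andP[ay ya] Ky] [v Vv hv]].
  rewrite leNgt; apply: contraTN hv => xy; rewrite -leNgt.
  by apply: (@height_between _ x y); [lra|lra|exact: Kx|exact: Ky].
exists c, c' => t ta Kt.
have [[v Vv hv]|np] := pselect (exists2 v, V v & height v (t + d) < 0).
  by apply: Or32; apply: cP; split => //; exists v.
have [[v Vv hv]|nm] := pselect (exists2 v, V v & height v (t - d) < 0).
  by apply: Or33; apply: c'P; split => //; exists v.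
apply: Or31 => v Vv; apply: height_rotations => //.
- exact: Vr.
- exact: sin_ge0_pi.
- exact: Kt.
- by rewrite leNgt; apply/negP => h; apply: np; exists v.
- by rewrite leNgt; apply/negP => h; apply: nm; exists v.
Qed.

(** By the mean value theorem sin d = d cos c with 0 < c < d <= 1, and cos decreases on [0, pi].
    This turns bounds in 1 / sin d into bounds in 1 / d. *)
Lemma sin_ge_linear d : 0 <= d <= 1 -> cos 1 * d <= sin d.
Proof.
move=> /andP[]; rewrite le_eqVlt => /predU1P[<- _|d0 d1].
  by rewrite mulr0 sin0.
have [|c] := @MVT R (@sin R) (@cos R) 0 d d0 (fun x _ => is_derive_sin x).
  by apply: continuous_subspaceT => x; exact: continuous_sin.
rewrite in_itv/= => /andP[c0 cd]; rewrite sin0 !subr0 => ->.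
have p2 := @pi_ge2 R.
by apply: ler_wpM2r; [lra|apply/ltW; rewrite ltr_cos ?in_itv/=; lra].
Qed.
End Height.

(** * Limits of measures and double counting *)

Section Measure.
Context {R : realType}.
Local Notation mu := (@lebesgue_measure R).

(** Monotonicity makes the right limit an infimum, which is then compared with the values along 1 /
    (k + 1), where continuity from above applies. *)
Lemma cvg_at_right_measure (F : R -> set R) :
  (forall e, 0 < e -> measurable (F e)) ->
  (forall e e', 0 < e -> e <= e' -> F e `<=` F e') ->
  (mu (F 1%R) < +oo)%E -> measurable (\bigcap_(e in [set e | 0 < e]) F e) ->
  mu (F e) @[e --> 0^'+] --> mu (\bigcap_(e in [set e | 0 < e]) F e).
Proof.
move=> mF ndF F1; set A := \bigcap_(_ in _) _ => mcap.
have ndmu : {in Interval (BRight 0) +oo%O &,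
    {homo (fun e => mu (F e)) : x y / x <= y >-> (x <= y)%E}}.
  move=> x y; rewrite !in_itv/= !andbT => x0 y0 xy.
  by apply: le_measure; rewrite ?inE; [exact: mF|exact: mF|exact: ndF].
have := @nondecreasing_at_right_cvge R (fun e => mu (F e)) 0 +oo%O isT ndmu.
set l := ereal_inf _; suff -> : l = mu A by [].
apply/eqP; rewrite eq_le; apply/andP; split; last first.
  apply: le_ereal_inf_tmp => y [e + <-]; rewrite /= in_itv/= andbT => e0.
  by apply: le_measure; rewrite ?inE//; [exact: mF|exact: bigcap_inf].
have Aseq : A = \bigcap_k F (harmonic k).
  apply/seteqP; split => [x Ax k _|x Ax e /= e0].
    by apply: Ax; exact: harmonic_gt0.
  have [k ke] : exists k, harmonic k <= e.
    have [k _ /(_ k (leqnn k))] := cvgr_le 0 (@cvg_harmonic R) e e0.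
    by exists k.
  exact: (ndF _ _ (harmonic_gt0 k) ke) (Ax k I).
have mS k : measurable (F (harmonic k)) by apply: mF; exact: harmonic_gt0.
have cv : mu \o (fun k => F (harmonic k)) @ \oo --> mu A.
  rewrite Aseq; apply: nonincreasing_cvg_mu => //=.
  - by rewrite invr1.
  - by rewrite Aseq in mcap.
  - move=> m k mk; rewrite subsetEset; apply: ndF => //=.
    by rewrite lef_pV2 ?posrE// ler_nat ltnS.
rewrite -(cvg_lim _ cv)//; apply: lime_ge; first exact: (cvgP _ cv).
apply: nearW => k; apply: ereal_inf_lbound => /=; exists (harmonic k) => //.
by rewrite /= in_itv/= andbT.
Qed.

Lemma measurable_angles n (Q : pred 'I_n) (S : 'I_n -> set R) :
  (forall j, Q j -> measurable (S j)) ->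
  measurable [set t | (0 <= t < 2 * pi) /\ forall j, Q j -> S j t].
Proof.
move=> mS; rewrite [X in measurable X](_ : _ =
    `[0, 2 * pi[%classic `&` \bigcap_(j in [set j | Q j]) S j).
  apply: measurableI => //; apply: fin_bigcap_measurable => //.
by apply/seteqP; split => t /=; rewrite in_itv.
Qed.

Lemma continuous_height (p : pt R) : continuous (height p).
Proof.
move=> t; apply: cvgD; apply: cvgM; [exact: cvg_cst|exact: continuous_cos|
  exact: cvg_cst|exact: continuous_sin].
Qed.

Lemma measurable_height_itv (p : pt R) (i : interval R) :
  measurable [set t | height p t \in i].
Proof.
have := continuous_measurable_fun (continuous_height p) measurableT
  (measurable_itv i).
by rewrite setTI.
Qed.

(** The sum of measures is the integral over [D] of the number of sets [G i] containing t. *)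
Lemma sum_measure_le_multiplicity n (G : 'I_n -> set R) (D : set R) (m : R) :
  measurable D -> (forall i, measurable (G i)) -> (forall i, G i `<=` D) ->
  (forall t, D t -> #|[set i | t \in G i]%SET|%:R <= m) ->
  (\sum_(i < n) mu (G i) <= m%:E * mu D)%E.
Proof.
move=> mD mG GD mult; rewrite -integral_cst//.
rewrite (eq_bigr (fun i => \int[mu]_(t in D) (\1_(G i) t)%:E)%E); last first.
  by move=> i _; rewrite integral_indic; [rewrite setIidl|exact: mD|exact: mG].
have mind i : measurable_fun D (fun t => (\1_(G i) t : R)%:E).
  by apply/measurable_EFinP; exact: measurable_indic.
rewrite -ge0_integral_sum//; apply: ge0_le_integral => //.
- by move=> t Dt; apply: sume_ge0 => i _; rewrite lee_fin.
- exact: emeasurable_sum.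
- move=> t Dt; rewrite /= sumEFin lee_fin; apply: le_trans (mult t Dt).
  rewrite -sum1_card natr_sum [leRHS]big_mkcond/= ler_sum// => i _.
  by rewrite inE indicE; case: (t \in G i).
Qed.
End Measure.

(** * Visible arcs, their limits, and the total length of the limits *)

Section Records.
Context {R : realType} {n : nat}.
Local Notation mu := (@lebesgue_measure R).
Implicit Types (P : 'I_n -> pt R) (f : {perm 'I_n}) (i j : 'I_n) (e s r d : R).

(** The case s = 0 is the limit of the visible arcs; a positive margin s makes it possible to count
    the records in one direction. *)
Definition record_angles s P f i : set R :=
  [set t | (0 <= t < 2 * pi) /\
           forall j, (f j < f i)%N -> s <= height (P i - P j) t].

Lemma record_angles_sub s P f i :
  record_angles s P f i `<=` `[0, 2 * pi[%classic.
Proof. by move=> t []; rewrite /= in_itv. Qed.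

Lemma lebesgue_measure_angles : mu `[0, 2 * pi[%classic = (2 * pi)%:E.
Proof.
by rewrite lebesgue_measure_itv/= lte_fin mulr_gt0 ?pi_gt0// sube0.
Qed.

Lemma measurable_record_angles s P f i : measurable (record_angles s P f i).
Proof.
apply: (@measurable_angles _ _ _ (fun j => [set t | s <= height (P i - P j) t])).
move=> j _; have := measurable_height_itv (P i - P j) `[s, +oo[.
by congr measurable; apply/seteqP; split => t; rewrite /= in_itv/= andbT.
Qed.

(** With v = P i - P j, the squared distance from the boundary point to the scaled centre of j is 1
    + 2e (height v t + e/2 |v|^2). The disks are closed, so visibility is a strict inequality. *)
Lemma visible_angles_scale e P f i : 0 < e ->
  visible_angles (scale_pts e P) f i =
  [set t | (0 <= t < 2 * pi) /\ forall j, (f j < f i)%N ->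
     - (e / 2 * sqnorm (P i - P j)) < height (P i - P j) t].
Proof.
move=> e0; have disk j t : unit_disk (scale_pts e P j)
    (circ_pt (scale_pts e P i) t) <->
    height (P i - P j) t <= - (e / 2 * sqnorm (P i - P j)).
  set v := P i - P j.
  rewrite /unit_disk/=.
  have -> : (e * (P i).1 + cos t - e * (P j).1) ^+ 2 +
      (e * (P i).2 + sin t - e * (P j).2) ^+ 2 =
      (cos t ^+ 2 + sin t ^+ 2) + 2 * e * (height v t + e / 2 * sqnorm v).
    by rewrite /height /sqnorm /v /=; field.
  by rewrite cos2Dsin2 gerDl pmulr_rle0 ?mulr_gt0// -[X in _ <-> is_true X]subr_le0 opprK.
apply/seteqP; split => t [t0 vt]; split=> // j /vt.
  by move=> /disk/negP; rewrite -ltNge.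
by move=> h /disk; rewrite leNgt h.
Qed.

Lemma measurable_visible_angles e P f i : 0 < e ->
  measurable (visible_angles (scale_pts e P) f i).
Proof.
move=> e0; rewrite visible_angles_scale//.
pose c j := - (e / 2 * sqnorm (P i - P j)).
apply: (@measurable_angles _ _ _ (fun j => [set t | c j < height (P i - P j) t])).
move=> j _; have := measurable_height_itv (P i - P j) `]c j, +oo[.
by congr measurable; apply/seteqP; split => t; rewrite /= in_itv/= andbT.
Qed.

Lemma visible_angles_mono P f i e e' : 0 < e -> e <= e' ->
  visible_angles (scale_pts e P) f i `<=` visible_angles (scale_pts e' P) f i.
Proof.
move=> e0 ee'; rewrite !visible_angles_scale ?(lt_le_trans e0)//.
move=> t [t0 ht]; split=> // j /ht; apply: le_lt_trans.
by rewrite lerN2 ler_wpM2r ?sqnorm_ge0//; lra.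
Qed.

(** The thresholds -(e/2)|v|^2 tend to 0 from below, and stay strictly below 0 because distinct
    indices give distinct points. *)
Lemma bigcap_visible_angles P f i : injective P ->
  \bigcap_(e in [set e | 0 < e]) visible_angles (scale_pts e P) f i =
  record_angles 0 P f i.
Proof.
move=> Pinj; apply/seteqP; split => t.
  move=> vt; split; first by have [] := vt 1 ltr01.
  move=> j ji; apply/ler_addgt0Pr => e e0.
  have S0 := sqnorm_ge0 (P i - P j); set S := sqnorm _ in S0.
  (* A scale with q S / 2 <= e; adding 1 keeps the denominator positive. *)
  set q := e / (S + 1).
  have S1 : 0 < S + 1 by lra.
  have q0 : 0 < q by rewrite divr_gt0.
  have := vt _ q0; rewrite visible_angles_scale// => -[_ /(_ _ ji)]; rewrite -/S.
  have qS : 0 <= q * S by rewrite mulr_ge0// ltW.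
  have -> : e = q * (S + 1) by rewrite divfK// gt_eqF.
  lra.
move=> [t0 rt] e /= e0; rewrite visible_angles_scale//; split=> // j ji.
apply: lt_le_trans (rt _ ji); rewrite oppr_lt0 mulr_gt0 ?divr_gt0//.
rewrite lt_neqAle sqnorm_ge0 andbT eq_sym; apply/eqP => /sqnorm_eq0 /eqP.
by rewrite subr_eq0 => /eqP/Pinj ij; rewrite ij ltnn in ji.
Qed.

Lemma vis_scale_cvg P f : injective P ->
  (fun e => vis (scale_pts e P) f) @ 0^'+ -->
    (\sum_(i < n) mu (record_angles 0 P f i))%E.
Proof.
move=> Pinj; apply: cvg_nnesum => i _; first exact: nearW.
rewrite -bigcap_visible_angles//; apply: cvg_at_right_measure.
- by move=> e; exact: measurable_visible_angles.
- by move=> e e'; exact: visible_angles_mono.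
- apply: (@le_lt_trans _ _ (mu `[0, 2 * pi[%classic)); last first.
    by rewrite lebesgue_measure_angles ltry.
  apply: le_measure; rewrite ?inE//; first exact: measurable_visible_angles.
  by move=> t []; rewrite /= in_itv.
- by rewrite bigcap_visible_angles//; exact: measurable_record_angles.
Qed.

(** Going through [S] in stacking order, each value exceeds the previous one by at least s, giving k
    gaps. The induction removes the element with the largest f. *)
Lemma separated_chain f (x : 'I_n -> R) s k (S : {set 'I_n}) : #|S| = k.+1 ->
  {in S &, forall i j, (f j < f i)%N -> s <= x i - x j} ->
  exists i j, [/\ i \in S, j \in S, {in S, forall l, (f l <= f i)%N} &
    k%:R * s <= x i - x j].
Proof.
elim: k S => [|k IH] S cS sep.
  have /card_gt0P[i iS] : (0 < #|S|)%N by rewrite cS.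
  exists i, i; split => //; last by rewrite mul0r subrr.
  move=> l lS; have /eqP/cards1P[y Sy] := cS.
  by move: iS lS; rewrite Sy !inE => /eqP-> /eqP->.
have /card_gt0P[i0 i0S] : (0 < #|S|)%N by rewrite cS.
case: (@arg_maxnP _ i0 (fun i => i \in S) (fun i => val (f i)) i0S) => i iS imax.
have cSi : #|S :\ i| = k.+1 by move: cS; rewrite (cardsD1 i) iS => -[].
have [|i' [j [i'S jS i'max kij]]] := IH (S :\ i) cSi.
  by move=> a b /setD1P[_ aS] /setD1P[_ bS]; exact: sep.
have [ni i'S'] := setD1P i'S; have [_ jS'] := setD1P jS.
exists i, j; split=> //.
have : s <= x i - x i'.
  apply: sep => //; rewrite ltn_neqAle [X in _ && X]imax// andbT.
  by apply: contra_neq ni => /val_inj/perm_inj.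
by rewrite -natr1; lra.
Qed.

(** The points that are records at t form a separated chain of heights, and the heights spread over
    at most [D]. *)
Lemma card_records_le s D P f t :
  0 < s -> (forall i j, dist (P i) (P j) <= D) -> 0 <= D ->
  #|[set i | t \in record_angles s P f i]%SET|%:R <= 1 + D / s.
Proof.
move=> s0 PD D0; set S := finset _.
case cS : #|S| => [|k]; first by rewrite addr_ge0// divr_ge0// ltW.
have [|i [j [_ _ _ kij]]] :=
    separated_chain f (fun i => height (P i) t) s k S cS.
  move=> i j; rewrite !inE => -[_ si] _ /si.
  by rewrite heightB.
rewrite -natr1 addrC lerD2l ler_pdivlMr//.
by rewrite (le_trans kij)// (le_trans (heightB_le_dist _ _ _)).
Qed.

Lemma measure_low_records_le r d P f i : 0 <= r -> 0 <= d <= pi ->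
  (forall j, j != i -> r <= dist (P i) (P j)) ->
  (mu (record_angles 0 P f i) <=
   mu (record_angles (r * sin d) P f i) + (8 * d)%:E)%E.
Proof.
move=> r0 dpi rP.
pose V : set (pt R) := [set v | exists2 j, (f j < f i)%N & v = P i - P j].
have Vr v : V v -> r ^+ 2 <= sqnorm v.
  move=> [j ji ->]; rewrite -dist_sqr ler_pXn2r ?nnegrE ?sqrtr_ge0//.
  by apply: rP; apply: contraTneq ji => ->; rewrite ltnn.
(* The circle is cut into two half-turns; each leaves two exceptional intervals of length 2d, for a
   total of 8d. *)
have [a1 [a2 a12]] := @low_angles_narrow R V 0 d r r0 dpi Vr.
have [a3 [a4 a34]] := @low_angles_narrow R V pi d r r0 dpi Vr.
pose B (a : R) : set R := `[a - d, a + d]%classic.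
have muB a : (mu (B a) <= (2 * d)%:E)%E.
  rewrite /B lebesgue_measure_itv/= lte_fin; have /andP[d0 _] := dpi.
  by case: ltP => h; rewrite -?EFinD lee_fin; lra.
have mB a : measurable (B a) by exact: measurable_itv.
have mU a b : measurable (B a `|` B b) by apply: measurableU; exact: mB.
set G := record_angles (r * sin d) P f i.
have mG : measurable G by exact: measurable_record_angles.
apply: (@le_trans _ _ (mu (G `|` (B a1 `|` B a2 `|` (B a3 `|` B a4))))).
  apply: le_measure; rewrite ?inE; first exact: measurable_record_angles.
    apply: measurableU; first exact: mG.
    by apply: measurableU; exact: mU.
  move=> t [/andP[t0 t2] rt].
  have Vt v : V v -> 0 <= height v t by move=> [j ji ->]; exact: rt.
  have Gt : (forall v, V v -> r * sin d <= height v t) -> G t.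
    by move=> h; split; [rewrite t0|move=> j ji; apply: h; exists j].
  have [tpi|pit] := ltP t pi.
    have [|/Gt|tB|tB] := a12 t _ Vt; first by rewrite add0r t0.
    - by left.
    - by right; left; left.
    - by right; left; right.
  have [|/Gt|tB|tB] := a34 t _ Vt; first by rewrite pit/=; lra.
  - by left.
  - by right; right; left.
  - by right; right; right.
have U2 a b : (mu (B a `|` B b) <= (4 * d)%:E)%E.
  apply: (le_trans (measureU2 mu (mB a) (mB b))).
  by apply: (le_trans (leeD (muB a) (muB b))); rewrite -EFinD lee_fin; lra.
have mU4 := measurableU _ _ (mU a1 a2) (mU a3 a4).
apply: (le_trans (measureU2 mu mG mU4)); rewrite leeD2l//.
apply: (le_trans (measureU2 mu (mU _ _) (mU _ _))).
by apply: (le_trans (leeD (U2 _ _) (U2 _ _))); rewrite -EFinD lee_fin; lra.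
Qed.

(** The ends of the n arcs cost 8d each. What remains are records with margin r sin d, counted
    direction by direction over a circle of length 2 pi. *)
Lemma sum_record_angles_le r d D P f : 0 < r -> 0 < d <= 1 ->
  (forall i j, i != j -> r <= dist (P i) (P j)) ->
  (forall i j, dist (P i) (P j) <= D) -> 0 <= D ->
  (\sum_(i < n) mu (record_angles 0 P f i) <=
   (8 * d * n%:R + (1 + D / (r * (cos 1 * d))) * (2 * pi))%:E)%E.
Proof.
move=> r0 /andP[d0 d1] rP PD D0.
have dpi : 0 <= d <= pi by have := @pi_ge2 R; lra.
have c1 : 0 < cos 1 * d by rewrite mulr_gt0 ?cos1_gt0.
have sd : cos 1 * d <= sin d by apply: sin_ge_linear; lra.
have sd0 := lt_le_trans c1 sd.
apply: (@le_trans _ _ (\sum_(i < n)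
    (mu (record_angles (r * sin d) P f i) + (8 * d)%:E))%E).
  apply: lee_sum => i _; apply: measure_low_records_le => //; first exact: ltW.
  by move=> j ji; apply: rP; rewrite eq_sym.
rewrite big_split/= sumEFin sumr_const card_ord -[(8 * d) *+ n]mulr_natr.
rewrite [leRHS]EFinD [leRHS]addeC leeD2r//.
apply: (le_trans (@sum_measure_le_multiplicity _ _ _ `[0, 2 * pi[%classic
  (1 + D / (r * sin d)) _ _ _ _)).
- exact: measurable_itv.
- by move=> i; exact: measurable_record_angles.
- by move=> i; exact: record_angles_sub.
- by move=> t _; apply: card_records_le => //; rewrite mulr_gt0.
rewrite lebesgue_measure_angles -EFinM lee_fin ler_wpM2r ?mulr_ge0 ?pi_ge0//.
rewrite lerD2l ler_wpM2l// lef_pV2 ?posrE ?(mulr_gt0 r0)//.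
by rewrite ler_pM2l.
Qed.

(** The witness is the minimum distance: it is attained by a pair, to which density applies. *)
Lemma dense_min_dist C P : 0 <= C -> injective P -> C_dense C P ->
  exists r, [/\ 0 < r, forall i j, i != j -> r <= dist (P i) (P j) &
    forall i j, dist (P i) (P j) <= C * Num.sqrt n%:R * r].
Proof.
move=> C0 Pinj dense.
have [[[k l] /= kl]|np] := pselect (exists p : 'I_n * 'I_n, p.1 != p.2).
  case: (@arg_minP _ _ _ (k, l) (fun p => p.1 != p.2)
    (fun p => dist (P p.1) (P p.2)) kl) => -[a b] /= ab abmin.
  exists (dist (P a) (P b)); split.
  - rewrite lt_neqAle sqrtr_ge0 andbT eq_sym; apply: contra_neqN ab => /eqP d0.
    apply/Pinj/eqP; rewrite -subr_eq0; apply/eqP/sqnorm_eq0.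
    by rewrite -dist_sqr d0 expr0n.
  - by move=> i j ij; exact: (abmin (i, j)).
  - by move=> i j; exact: dense.
(* Without two distinct indices all distances vanish, and 1 is an arbitrary positive choice. *)
exists 1; split => // i j; first by move=> ij; case: np; exists (i, j).
have -> : i = j by apply/eqP/negPn/negP => ij; apply: np; exists (i, j).
have -> : dist (P j) (P j) = 0 by rewrite /dist !subrr expr0n/= addr0 sqrtr0.
by rewrite mulr1 mulr_ge0// sqrtr_ge0.
Qed.
End Records.

Theorem theorem2 (R : realType) (C : R) (hC : 0 < C) :
  exists C' : R, 0 < C' /\
    forall (n : nat) (P : 'I_n -> pt R) (f : {perm 'I_n}),
      (0 < n)%N -> injective P -> C_dense C P ->
      exists L : R,
        ((fun eps : R => vis (scale_pts eps P) f) @ 0^'+ --> L%:E)%E /\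
        L <= C' * (n%:R `^ (3 / 4)).
Proof.
have pi0 := @pi_gt0 R; have c0 := @cos1_gt0 R.
(* The three terms come from the arc ends, from the 1 in the multiplicity bound, and from its
   quotient [D / s]. *)
exists (8 + 2 * pi + C / cos 1 * (2 * pi)); split.
  by rewrite !addr_gt0// ?mulr_gt0// ?invr_gt0.
move=> n P f n0 Pinj dense.
have [r [r0 rP Pr]] := dense_min_dist C P (ltW hC) Pinj dense.
(* In terms of x = n^(1/4) all powers are integral: n = x^4, sqrt n = x^2, and the target is x^3.
   The choice d = 1/x balances n d against sqrt n / d; the distance r cancels. *)
set x : R := n%:R `^ (1 / 4); set y := n%:R `^ _.
have n0R : 0 < n%:R :> R by rewrite ltr0n.
have x0 : 0 < x by exact: powR_gt0.
have nx : n%:R = x ^+ 4 :> R.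
  by rewrite -powR_mulrn ?powR_ge0// -powRrM mul1r mulVf// powRr1 ?ltW.
have yx : y = x ^+ 3.
  rewrite -powR_mulrn ?powR_ge0// -powRrM; congr powR; lra.
have sx : Num.sqrt n%:R = x ^+ 2.
  by rewrite nx (exprM x 2 2) sqrtr_sqr ger0_norm// sqr_ge0.
have x1 : 1 <= x.
  by rewrite -(powRr0 (n%:R : R)) ler_powR ?ler1n//; lra.
have dx : 0 < x^-1 <= 1 by rewrite invr_gt0 x0 invf_le1.
have D0 : 0 <= C * Num.sqrt n%:R * r.
  by rewrite !mulr_ge0 ?sqrtr_ge0// ltW.
have bound := sum_record_angles_le r x^-1 _ P f r0 dx rP Pr D0.
set S := (\sum_(i < n) _)%E in bound.
have S0 : (0 <= S)%E by apply: sume_ge0 => i _; exact: measure_ge0.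
have Sfin : S \is a fin_num.
  by rewrite ge0_fin_numE// (le_lt_trans bound)// ltry.
exists (fine S); split; first by rewrite fineK//; exact: vis_scale_cvg.
rewrite -lee_fin fineK// (le_trans bound)// lee_fin yx sx nx.
have -> : 8 * x^-1 * x ^+ 4 = 8 * x ^+ 3 by field; rewrite gt_eqF.
have -> : C * x ^+ 2 * r / (r * (cos 1 * x^-1)) = C / cos 1 * x ^+ 3.
  by field; rewrite !gt_eqF.
(* The constant term 2 pi is absorbed since x >= 1. *)
have : 1 * (2 * pi) <= x ^+ 3 * (2 * pi).
  by rewrite ler_wpM2r ?exprn_ege1// mulr_ge0// ltW.
lra.
Qed.
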